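(* Let $\mathfrak J_{\mathrm{gen}}$ be a generating collection of partitions. Suppose that: - $\psi:\mathcal C\to\mathbb R$ is $\mathcal C^*$-increasing and continuous; - $\mathsf H:\mathcal H\to\mathbb R$ satisfies $\mathsf H(\nu^{(j)})\le\mathsf H(\nu)$ for every $\nu\in\mathcal C$ and every $j\in\mathfrak J_{\mathrm{gen}}$; - for each $j\in\mathfrak J_{\mathrm{gen}}$, $f_j:\mathbb R_+\times\mathcal C^j\to(-\infty,\infty]$ is given by $$f_j(t,x)=\sup_{y\in\mathcal C^j}\inf_{z\in\mathcal C^j}\big\{\psi^j(x+y)-\langle y,z\rangle_{\mathcal H^j}+t\,\mathsf H^j(z)\big\},\quad\forall(t,x)\in\mathbb R_+\times\mathcal C^j.$$ If $\lim_{j\in\mathfrak J_{\mathrm{gen}}}f_j^\uparrow(t,\mu)$ exists in $\mathbb R$ at some $(t,\mu)\in\mathbb R_+\times\mathcal C$, then the limit is equal to $$f(t,\mu)=\sup_{\nu\in\mathcal C}\inf_{\rho\in\mathcal C}\big\{\psi(\mu+\nu)-\langle\nu,\rho\rangle_{\mathcal H}+t\,\mathsf H(\rho)\big\}.$$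
   Context: $\mathbb R_+=[0,\infty)$. Fix an integer $D\ge1$. $\mathbb S^D$ is the space of real symmetric $D\times D$ matrices with inner product $a\cdot b=\mathrm{tr}(ab)$ and norm $|a|=\sqrt{a\cdot a}$; $\mathbb S^D_+$ is the cone of positive semidefinite matrices; $a\ge b$ means $a-b\in\mathbb S^D_+$. $\mathcal H=L^2([0,1);\mathbb S^D)$ (Lebesgue measure) with $\langle\iota,\kappa\rangle_{\mathcal H}=\int_0^1\iota(s)\cdot\kappa(s)\,ds$. $\mathcal C\subset\mathcal H$ is the closed convex cone of (classes of) functions $\mu:[0,1)\to\mathbb S^D_+$ that are square-integrable, right-continuous with left limits, and increasing, i.e. $\mu(t)-\mu(s)\in\mathbb S^D_+$ for $t\ge s$. $\mathcal C^*=\{\iota\in\mathcal H:\langle\iota,\mu\rangle_{\mathcal H}\ge0\ \forall\mu\in\mathcal C\}$; $g:\mathcal C\to\mathbb R$ is $\mathcal C^*$-increasing if $g(\mu)\ge g(\mu')$ whenever $\mu-\mu'\in\mathcal C^*$. Partitions. A partition is a tuple $j=(t_1,\dots,t_n)$ with $0<t_1<\dots<t_n=1$; $|j|=n$, $t_0=0$. Partitions are ordered by inclusion of the underlying sets. A collection of partitions is directed if any two members are both included in a third member; it is generating if it is directed and the sigma-algebras generated by the intervals $[t_{k-1},t_k)$, $1\le k\le|j|$, over all its members $j$, together generate the Borel sigma-algebra of $[0,1)$. For nets indexed by a directed collection, $\lim_jx_j=x$ means: for each neighborhood $\mathcal N$ of $x$ there is a member $j_{\mathcal N}$ with $x_j\in\mathcal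 N$ for all members $j\supset j_{\mathcal N}$. For a partition $j$: $\mathcal H^j=(\mathbb S^D)^{|j|}$ with $\langle x,y\rangle_{\mathcal H^j}=\sum_k(t_k-t_{k-1})x_k\cdot y_k$; $\mathcal C^j=\{x\in\mathcal H^j:0\le x_1\le\dots\le x_{|j|}\}$; $\mathrm p_j:\mathcal H\to\mathcal H^j$, $(\mathrm p_j\iota)_k=\frac1{t_k-t_{k-1}}\int_{t_{k-1}}^{t_k}\iota(s)ds$; $\mathrm l_j:\mathcal H^j\to\mathcal H$, $\mathrm l_jx=\sum_kx_k\mathbf 1_{[t_{k-1},t_k)}$; $\iota^{(j)}=\mathrm l_j\mathrm p_j\iota$; $\psi^j=\psi\circ\mathrm l_j$ on $\mathcal C^j$, $\mathsf H^j=\mathsf H\circ\mathrm l_j$ on $\mathcal H^j$; for $g$ on $\mathbb R_+\times\mathcal C^j$, $g^\uparrow(t,\mu)=g(t,\mathrm p_j\mu)$ on $\mathbb R_+\times\mathcal C$. No assumption is made that $f_j$ or $f$ solves any equation. *)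

(* Defs.v *)
From HB Require Import structures.
From mathcomp Require Import all_boot all_order all_algebra.
From mathcomp Require Import generic_quotient ring_quotient sesquilinear.
From mathcomp Require Import all_classical all_reals all_analysis measurable_realfun.
From mathcomp Require Import ring lra.

Set Implicit Arguments.
Unset Strict Implicit.
Unset Printing Implicit Defensive.
Import Order.TTheory GRing.Theory Num.Theory.
Import numFieldNormedType.Exports.

Local Open Scope classical_set_scope.
Local Open Scope ring_scope.

Section PreHilbert.
Context {R : realType} {V : lmodType R} (dot : V -> V -> R).
Hypothesis dotC : forall x y, dot x y = dot y x.
Hypothesis dotDl : forall x y z, dot (x + y) z = dot x z + dot y z.
Hypothesis dotZl : forall a x y, dot (a *: x) y = a * dot x y.
Hypothesis dot_ge0 : forall x, 0 <= dot x x.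

Lemma dot_sqrtD (x y : V) :
  Num.sqrt (dot (x + y) (x + y)) <=
  Num.sqrt (dot x x) + Num.sqrt (dot y y).
Proof.
have dotDr u v w : dot u (v + w) = dot u v + dot u w.
  by rewrite dotC dotDl !(dotC u).
have dotZr a u v : dot u (a *: v) = a * dot u v by rewrite dotC dotZl dotC.
set a := Num.sqrt (dot x x); set b := Num.sqrt (dot y y).
have a0 : 0 <= a by exact: sqrtr_ge0.
have b0 : 0 <= b by exact: sqrtr_ge0.
have aE : dot x x = a ^+ 2 by rewrite sqr_sqrtr.
have bE : dot y y = b ^+ 2 by rewrite sqr_sqrtr.
have quad s t : 0 <= s ^+ 2 * a ^+ 2 + s * t * dot x y *+ 2 + t ^+ 2 * b ^+ 2.
  have := dot_ge0 (s *: x + t *: y).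
  rewrite dotDl !dotDr !dotZl !dotZr aE bE (dotC y x).
  by move=> /le_trans; apply; rewrite le_eqVlt; apply/orP; left; apply/eqP; ring.
have CS : dot x y <= a * b.
  have [a_eq0|a_neq0] := eqVneq a 0.
    have [//|xy_gt0] := leP (dot x y) (a * b).
    move: xy_gt0; rewrite a_eq0 mul0r => xy_gt0.
    have := quad (- (b ^+ 2 + 1)) (dot x y).
    rewrite a_eq0; have := sqr_ge0 b; have := exprn_gt0 2 xy_gt0; nra.
  have [b_eq0|b_neq0] := eqVneq b 0.
    have [//|xy_gt0] := leP (dot x y) (a * b).
    move: xy_gt0; rewrite b_eq0 mulr0 => xy_gt0.
    have := quad (dot x y) (- (a ^+ 2 + 1)).
    rewrite b_eq0; have := sqr_ge0 a; have := exprn_gt0 2 xy_gt0; nra.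
  have ab : 0 < a * b by rewrite mulr_gt0// lt_def ?a_neq0 ?b_neq0.
  have := quad b (- a); nra.
rewrite -(@ler_pXn2r _ 2) ?nnegrE ?addr_ge0 ?sqrtr_ge0//.
rewrite sqr_sqrtr ?dot_ge0// dotDl !dotDr aE bE (dotC y x); nra.
Qed.

Lemma dot_sqrtZ a (x : V) :
  Num.sqrt (dot (a *: x) (a *: x)) = `|a| * Num.sqrt (dot x x).
Proof.
by rewrite dotZl dotC dotZl mulrA -expr2 sqrtrM ?sqr_ge0// sqrtr_sqr.
Qed.

End PreHilbert.

Section SymmetricMatrices.
Context {R : realType} {D : nat}.

Lemma symmetricmxP (A : 'M[R]_D) : reflect (A^T = A) (A \is symmetricmx).
Proof.
apply: (iffP (is_hermitianmxP _ _ _)); rewrite expr0 scale1r map_mx_id//.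
Qed.

Lemma symmetricmx_submod_closed :
  submod_closed [pred A : 'M[R]_D | A \is symmetricmx].
Proof.
split=> [|a A B /symmetricmxP AE /symmetricmxP BE]; apply/symmetricmxP.
  exact: trmx0.
by rewrite linearD linearZ/= AE BE.
Qed.

End SymmetricMatrices.

HB.instance Definition _ (R : realType) (D : nat) :=
  GRing.isSubmodClosed.Build R 'M[R]_D [pred A : 'M[R]_D | A \is symmetricmx]
    symmetricmx_submod_closed.

Record symmx (R : realType) (D : nat) := Symmx {
  symmx_val :> 'M[R]_D;
  _ : [pred A : 'M[R]_D | A \is symmetricmx] symmx_val }.

HB.instance Definition _ (R : realType) (D : nat) :=
  [isSub of symmx R D for @symmx_val R D].
HB.instance Definition _ (R : realType) (D : nat) :=
  [Choice of symmx R D by <:].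
HB.instance Definition _ (R : realType) (D : nat) :=
  [SubChoice_isSubLmodule of symmx R D by <:].

Section Frobenius.
Context {R : realType} {D : nat}.
Implicit Types a b c : symmx R D.

Definition sdot a b : R := \tr (a *m b).

Definition psd a : Prop := forall v : 'rV[R]_D, 0 <= (v *m a *m v^T) 0 0.

Lemma symmxD a b : (a + b : symmx R D) = (a : 'M[R]_D) + b :> 'M[R]_D.
Proof. by []. Qed.

Lemma symmxZ (l : R) a : (l *: a : symmx R D) = l *: (a : 'M[R]_D) :> 'M[R]_D.
Proof. by []. Qed.

Lemma symmx0 : (0 : symmx R D) = 0 :> 'M[R]_D.
Proof. by []. Qed.

Lemma trmx_symmx a : (a : 'M[R]_D)^T = a.
Proof. by case: a => a ap; apply/symmetricmxP. Qed.

Lemma sdotE a b : sdot a b = \sum_i \sum_j a i j * b i j.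
Proof.
rewrite /sdot /mxtrace; apply: eq_bigr => i _; rewrite mxE.
by apply: eq_bigr => j _; rewrite -[in RHS](trmx_symmx b) [in RHS]mxE.
Qed.

Lemma sdotC a b : sdot a b = sdot b a.
Proof. by rewrite /sdot mxtrace_mulC. Qed.

Lemma sdotDl a b c : sdot (a + b) c = sdot a c + sdot b c.
Proof. by rewrite /sdot symmxD mulmxDl mxtraceD. Qed.

Lemma sdotZl (l : R) a b : sdot (l *: a) b = l * sdot a b.
Proof. by rewrite /sdot symmxZ -scalemxAl mxtraceZ. Qed.

Lemma sdot_ge0 a : 0 <= sdot a a.
Proof.
by rewrite sdotE; do 2!apply: sumr_ge0 => ? _; rewrite -expr2 sqr_ge0.
Qed.

Lemma sdot_eq0 a : sdot a a = 0 -> a = 0.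
Proof.
rewrite sdotE => /eqP; rewrite psumr_eq0 => [/allP/= a0|i _]; last first.
  by apply: sumr_ge0 => ? _; rewrite -expr2 sqr_ge0.
apply/val_inj/matrixP => i j /=.
have := a0 i (mem_index_enum _); rewrite psumr_eq0 => [/allP/= ai0|k _].
  have := ai0 j (mem_index_enum _); rewrite -expr2 sqrf_eq0 => /eqP ->.
  by rewrite mxE.
by rewrite -expr2 sqr_ge0.
Qed.

Definition snorm a : R := Num.sqrt (sdot a a).

Lemma ler_snormD a b : snorm (a + b) <= snorm a + snorm b.
Proof.
exact: (@dot_sqrtD R (symmx R D) sdot sdotC sdotDl sdotZl sdot_ge0).
Qed.

Lemma snormZ (l : R) a : snorm (l *: a) = `|l| * snorm a.
Proof. exact: (@dot_sqrtZ R (symmx R D) sdot sdotC sdotZl). Qed.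

Lemma snorm0_eq0 a : snorm a = 0 -> a = 0.
Proof.
by move/eqP; rewrite sqrtr_eq0 => a0; apply/sdot_eq0/le_anti; rewrite a0 sdot_ge0.
Qed.

End Frobenius.

HB.instance Definition _ (R : realType) (D : nat) :=
  @Lmodule_isNormed.Build R (symmx R D) snorm (@ler_snormD R D) (@snormZ R D)
    (@snorm0_eq0 R D).

Section SquareIntegrable.
Context {R : realType} {D : nat}.
Local Notation leb := (@lebesgue_measure R).
Local Notation I := (`[0, 1[%classic : set R).

(* Square-integrability on [0, 1) for the Frobenius norm. Elements of the L^2
   space are represented by functions on the whole line: their values outside
   [0, 1) are irrelevant. Borel measurability is stated entrywise. *)
Definition sqint (f : R -> symmx R D) : Prop :=
  (forall i j, measurable_fun I (fun s => f s i j)) /\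
  (\int[leb]_(s in I) (`|f s| ^+ 2)%:E < +oo)%E.

Lemma sqr_normE (a : symmx R D) : `|a| ^+ 2 = sdot a a.
Proof. by rewrite /Num.norm/= sqr_sqrtr// sdot_ge0. Qed.

Lemma measurable_sdot (f g : R -> symmx R D) :
  (forall i j, measurable_fun I (fun s => f s i j)) ->
  (forall i j, measurable_fun I (fun s => g s i j)) ->
  measurable_fun I (fun s => sdot (f s) (g s)).
Proof.
move=> mf mg; rewrite (_ : (fun s => _) =
  (fun s => \sum_i \sum_j f s i j * g s i j)); last first.
  by apply/funext => s; rewrite sdotE.
apply: measurable_sum => i; apply: measurable_sum => j.
exact: measurable_funM.
Qed.

Lemma sdot_le (a b : symmx R D) : `|sdot a b| <= `|a| ^+ 2 + `|b| ^+ 2.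
Proof.
have P := sdot_ge0 (a + b); have M := sdot_ge0 (a + (-1) *: b).
have A := sdot_ge0 a; have B := sdot_ge0 b.
move: P M; rewrite !sdotDl !(sdotC _ (_ + _)) !sdotDl !sdotZl.
rewrite !(sdotC _ (_ *: _)) !sdotZl (sdotC b a).
rewrite !sqr_normE ler_norml => P M; apply/andP; split; nra.
Qed.

Lemma sqint_sdot (f g : R -> symmx R D) : sqint f -> sqint g ->
  leb.-integrable I (fun s => (sdot (f s) (g s))%:E).
Proof.
move=> [mf f2] [mg g2].
have sq (h : R -> symmx R D) :
    (forall i j, measurable_fun I (fun s => h s i j)) ->
    measurable_fun I (fun s => (`|h s| ^+ 2)%:E).
  move=> mh; rewrite (_ : (fun _ => _) = fun s => (sdot (h s) (h s))%:E).
    by apply/measurable_EFinP; exact: measurable_sdot.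
  by apply/funext => s; rewrite sqr_normE.
apply/integrableP; split.
  by apply/measurable_EFinP; exact: measurable_sdot.
apply: (@le_lt_trans _ _
    (\int[leb]_(s in I) ((`|f s| ^+ 2)%:E + (`|g s| ^+ 2)%:E))%E).
  apply: ge0_le_integral => //.
  - apply: measurableT_comp => //.
    by apply/measurable_EFinP; exact: measurable_sdot.
  - by apply: emeasurable_funD; exact: sq.
  - by move=> s _; rewrite abse_EFin -EFinD lee_fin sdot_le.
rewrite ge0_integralD//=; [by rewrite lte_add_pinfty|exact: sq|exact: sq].
Qed.

Lemma sqint_submod_closed : submod_closed (mem [set f | sqint f]).
Proof.
split=> [|a f g].
  rewrite inE/=; split=> [i j|].
    rewrite (_ : (fun s => _) = cst 0)//; apply/funext => s.
    by have -> : (0 : R -> symmx R D) s = 0 by []; rewrite symmx0 mxE.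
  under eq_integral do rewrite normr0 expr0n/=.
  by rewrite integral0 ltry.
rewrite !inE/= => fi gi; have [[mf f2] [mg g2]] := (fi, gi).
have mfg i j : measurable_fun I (fun s => (a *: f + g) s i j).
  rewrite (_ : (fun s => _) = (fun s => a * f s i j + g s i j)); last first.
    apply/funext => s; have -> : (a *: f + g) s = a *: f s + g s by [].
    by rewrite symmxD symmxZ !mxE.
  by apply: measurable_funD => //; apply: measurable_funM => //.
split=> //.
have := sqint_sdot fi fi; have := sqint_sdot gi gi; have := sqint_sdot fi gi.
move=> ifg igg iff.
have : leb.-integrable I (fun s => ((a ^+ 2)%:E * (sdot (f s) (f s))%:E +
    ((a *+ 2)%:E * (sdot (f s) (g s))%:E + (sdot (g s) (g s))%:E))%E).
  apply: integrableD => //; first exact: integrableZl.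
  by apply: integrableD => //; exact: integrableZl.
move/integrableP => [_]; apply: le_lt_trans.
rewrite le_eqVlt; apply/orP; left; apply/eqP.
apply: eq_integral => s _; rewrite -!EFinM -!EFinD abse_EFin; congr EFin.
have -> : a ^+ 2 * sdot (f s) (f s) +
    (a *+ 2 * sdot (f s) (g s) + sdot (g s) (g s)) =
    sdot ((a *: f + g) s) ((a *: f + g) s).
  have -> : (a *: f + g) s = a *: f s + g s by [].
  rewrite !sdotDl !sdotZl !(sdotC _ (_ + _)) !sdotDl !sdotZl (sdotC (g s)).
  ring.
by rewrite ger0_norm ?sdot_ge0// sqr_normE.
Qed.

End SquareIntegrable.

Definition sqint_pred (R : realType) (D : nat) : {pred R -> symmx R D} :=
  mem [set f : R -> symmx R D | sqint f].

HB.instance Definition _ (R : realType) (D : nat) :=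
  GRing.isSubmodClosed.Build R (R -> symmx R D) (@sqint_pred R D)
    sqint_submod_closed.

Record sqfun (R : realType) (D : nat) := Sqfun {
  sqfun_val :> R -> symmx R D;
  _ : @sqint_pred R D sqfun_val }.

HB.instance Definition _ (R : realType) (D : nat) :=
  [isSub of sqfun R D for @sqfun_val R D].
HB.instance Definition _ (R : realType) (D : nat) :=
  [Choice of sqfun R D by <:].
HB.instance Definition _ (R : realType) (D : nat) :=
  [SubChoice_isSubLmodule of sqfun R D by <:].

Section NullFunctions.
Context {R : realType} {D : nat}.
Local Notation leb := (@lebesgue_measure R).
Local Notation I := (`[0, 1[%classic : set R).

Lemma ae_filter_leb : Filter (almost_everywhere leb).
Proof. exact: ae_filter_ringOfSetsType. Qed.

Lemma sqfunP (f : sqfun R D) : sqint f.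
Proof. by case: f => f /= /set_mem. Qed.

Lemma mem_sqint (f : R -> symmx R D) :
  sqint f -> sqint_pred f.
Proof. by move=> ?; apply/mem_set. Qed.

Definition mk_sqfun (f : R -> symmx R D) (fi : sqint f) : sqfun R D :=
  Sqfun (mem_sqint fi).

Definition ae_null : {pred sqfun R D} :=
  mem [set f : sqfun R D | f = cst 0 %[ae leb in I]].

Lemma ae_null_submod_closed : submod_closed ae_null.
Proof.
split; first by rewrite inE/=; apply: aeW => s _.
move=> a f g; rewrite !inE/= => f0 g0.
have FF := ae_filter_leb; apply: filterS2 f0 g0 => s f0 g0 Is.
change (a *: f s + g s = 0).
by rewrite f0// g0// scaler0 addr0.
Qed.

End NullFunctions.

HB.instance Definition _ (R : realType) (D : nat) :=
  GRing.isSubmodClosed.Build R (sqfun R D) (@ae_null R D)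
    ae_null_submod_closed.

(* Square-integrable functions modulo equality almost everywhere on [0, 1). *)
Definition L2 (R : realType) (D : nat) := Quotient.quot (@ae_null R D).

HB.instance Definition _ (R : realType) (D : nat) := GRing.Zmodule.on (L2 R D).
HB.instance Definition _ (R : realType) (D : nat) :=
  EqQuotient.on (L2 R D).

Section L2space.
Context {R : realType} {D : nat}.
Local Notation leb := (@lebesgue_measure R).
Local Notation I := (`[0, 1[%classic : set R).
Local Notation H := (L2 R D).
Local Open Scope quotient_scope.

Definition l2_class (f : sqfun R D) : H := \pi_H f.

Lemma l2_classP (f g : sqfun R D) :
  l2_class f = l2_class g <-> f = g %[ae leb in I].
Proof.
have FF := @ae_filter_leb R; split.
  move=> /eqP; rewrite /l2_class -Quotient.idealrBE inE/= => /filterS; apply.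
  move=> s fg Is; apply/eqP; rewrite -subr_eq0; apply/eqP.
  by have := fg Is.
move=> fg; apply/eqP; rewrite /l2_class -Quotient.idealrBE inE/=.
apply: filterS fg => s fg Is; change (f s - g s = 0).
by rewrite fg// subrr.
Qed.

Lemma l2_classD (f g : sqfun R D) :
  l2_class (f + g) = l2_class f + l2_class g.
Proof. by rewrite /l2_class raddfD. Qed.

Lemma l2_class0 : l2_class 0 = 0 :> H.
Proof. by rewrite /l2_class raddf0. Qed.

Lemma l2_reprK (x : H) : l2_class (repr x) = x.
Proof. exact: reprK. Qed.

Lemma l2_repr_class (f : sqfun R D) :
  repr (l2_class f) = f %[ae leb in I].
Proof. by apply/l2_classP; rewrite l2_reprK. Qed.

Definition l2_scale (a : R) (x : H) : H := l2_class (a *: repr x).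

Lemma l2_scaleE a f : l2_scale a (l2_class f) = l2_class (a *: f).
Proof.
have FF := @ae_filter_leb R; apply/l2_classP.
apply: filterS (l2_repr_class f) => s fs Is.
by change (a *: (repr (l2_class f) : sqfun R D) s = a *: f s); rewrite fs.
Qed.

Lemma l2_scaleA a b x : l2_scale a (l2_scale b x) = l2_scale (a * b) x.
Proof. by rewrite -(l2_reprK x) !l2_scaleE scalerA. Qed.

Lemma l2_scale1 : left_id 1 l2_scale.
Proof. by move=> x; rewrite -(l2_reprK x) l2_scaleE scale1r. Qed.

Lemma l2_scaleDr : right_distributive l2_scale +%R.
Proof.
move=> a x y; rewrite -(l2_reprK x) -(l2_reprK y).
by rewrite -l2_classD !l2_scaleE -l2_classD scalerDr.
Qed.

Lemma l2_scaleDl x : {morph l2_scale^~ x : a b / a + b}.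
Proof.
by move=> a b; rewrite -(l2_reprK x) !l2_scaleE -l2_classD scalerDl.
Qed.

HB.instance Definition _ := GRing.Zmodule_isLmodule.Build R H
  l2_scaleA l2_scale1 l2_scaleDr l2_scaleDl.

Lemma l2_classZ a (f : sqfun R D) : l2_class (a *: f) = a *: l2_class f.
Proof. by rewrite -l2_scaleE. Qed.

(* Does not depend on the representatives, see [l2_dotE]. *)
Definition l2_dot (x y : H) : R :=
  \int[leb]_(s in I) sdot ((repr x : sqfun R D) s) ((repr y : sqfun R D) s).

Lemma integrable_sdot (f g : sqfun R D) :
  leb.-integrable I (fun s => (sdot (f s) (g s))%:E).
Proof. by apply: sqint_sdot; exact: sqfunP. Qed.

Lemma l2_dotE (f g : sqfun R D) :
  l2_dot (l2_class f) (l2_class g) = \int[leb]_(s in I) sdot (f s) (g s).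
Proof.
have FF := @ae_filter_leb R; congr fine; apply: ae_eq_integral => //.
- by have /integrableP[] := integrable_sdot
    (repr (l2_class f) : sqfun R D) (repr (l2_class g) : sqfun R D).
- by have /integrableP[] := integrable_sdot f g.
apply: filterS2 (l2_repr_class f) (l2_repr_class g) => s fs gs Is.
by rewrite fs// gs.
Qed.

Lemma l2_dotC x y : l2_dot x y = l2_dot y x.
Proof. by apply: eq_Rintegral => s _; rewrite sdotC. Qed.

Lemma l2_dotDl x y z : l2_dot (x + y) z = l2_dot x z + l2_dot y z.
Proof.
rewrite -(l2_reprK x) -(l2_reprK y) -(l2_reprK z) -l2_classD !l2_dotE.
rewrite -RintegralD//; try exact: integrable_sdot.
by apply: eq_Rintegral => s _; rewrite -sdotDl.
Qed.

Lemma l2_dotZl a x y : l2_dot (a *: x) y = a * l2_dot x y.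
Proof.
rewrite -(l2_reprK x) -(l2_reprK y) -l2_classZ !l2_dotE.
rewrite -RintegralZl//; last exact: integrable_sdot.
by apply: eq_Rintegral => s _; rewrite -sdotZl.
Qed.

Lemma l2_dot_ge0 x : 0 <= l2_dot x x.
Proof. by apply: Rintegral_ge0 => s _; exact: sdot_ge0. Qed.

Lemma l2_dot_eq0 x : l2_dot x x = 0 -> x = 0.
Proof.
have FF := @ae_filter_leb R.
rewrite -(l2_reprK x) l2_dotE; set f : sqfun R D := repr x => f0.
have /integrableP[mf _] := integrable_sdot f f.
rewrite -l2_class0; apply/l2_classP.
have : (\int[leb]_(s in I) `|(sdot (f s) (f s))%:E| = 0)%E.
  under eq_integral do rewrite abse_EFin ger0_norm ?sdot_ge0//.
  have /fineK <- : (\int[leb]_(s in I) (sdot (f s) (f s))%:E)%E \is a fin_num.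
    by apply: integrable_fin_num => //; exact: integrable_sdot.
  by rewrite (_ : fine _ = 0).
move/ae_eq_integral_abs => /(_ _ mf) h.
have {}h := h (measurable_itv _).
apply: filterS h => s fs0 Is; change (f s = 0); apply: sdot_eq0.
by have [] := fs0 Is.
Qed.

Definition l2_norm (x : H) : R := Num.sqrt (l2_dot x x).

Lemma ler_l2_normD x y : l2_norm (x + y) <= l2_norm x + l2_norm y.
Proof. exact: (@dot_sqrtD R H l2_dot l2_dotC l2_dotDl l2_dotZl l2_dot_ge0). Qed.

Lemma l2_normZ a x : l2_norm (a *: x) = `|a| * l2_norm x.
Proof. exact: (@dot_sqrtZ R H l2_dot l2_dotC l2_dotZl). Qed.

Lemma l2_norm0_eq0 x : l2_norm x = 0 -> x = 0.
Proof.
move/eqP; rewrite sqrtr_eq0 => x0; apply/l2_dot_eq0/le_anti.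
by rewrite x0 l2_dot_ge0.
Qed.

HB.instance Definition _ := @Lmodule_isNormed.Build R H l2_norm
  ler_l2_normD l2_normZ l2_norm0_eq0.

End L2space.

Section Cone.
Context {R : realType} {D : nat}.
Local Notation I := (`[0, 1[%classic : set R).
Local Notation H := (L2 R D).

Definition cadlag (f : R -> symmx R D) : Prop :=
  (forall t, 0 <= t < 1 -> f s @[s --> t^'+] --> f t) /\
  (forall t, 0 < t < 1 -> cvg (f s @[s --> t^'-])).

Definition psd_increasing (f : R -> symmx R D) : Prop :=
  forall s t, 0 <= s -> s <= t -> t < 1 -> psd (f t - f s).

Definition cone : set H :=
  [set l2_class f | f in [set f : sqfun R D |
    [/\ forall s, 0 <= s < 1 -> psd (f s), cadlag f & psd_increasing f]]].

Definition dual_cone : set H :=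
  [set x | forall mu, cone mu -> 0 <= l2_dot x mu].

(* Functionals on the cone are total functions used on the cone only. *)
Definition dual_increasing (g : H -> R) : Prop :=
  forall mu mu', cone mu -> cone mu' -> dual_cone (mu - mu') -> g mu' <= g mu.

End Cone.

(* The tuple [(t_1, ..., t_n)]; [itv_partition 0 1] says that
   [0 < t_1 < ... < t_n = 1]. *)
Record partition01 (R : realType) := Partition {
  points :> seq R;
  _ : itv_partition 0 1 points }.

Section Partitions.
Context {R : realType}.
Implicit Types (j : partition01 R) (J : set (partition01 R)).

(* [knot j k] is [t_k], with [t_0 = 0]. *)
Definition knot j (k : nat) : R := nth 1 (0 :: points j) k.

(* Indices in ['I_(size j)] start at 0: [cell j k] is [[t_k, t_{k+1})]. *)
Definition cell j (k : 'I_(size j)) : set R := `[knot j k, knot j k.+1[.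

Definition cell_len j (k : 'I_(size j)) : R := knot j k.+1 - knot j k.

Definition refines j j' : Prop := {subset points j <= points j'}.

Definition directed J : Prop :=
  forall j1 j2, J j1 -> J j2 ->
    exists j3, [/\ J j3, refines j1 j3 & refines j2 j3].

Definition cell_sigma j : set (set R) :=
  <<s `[0, 1[, [set A | exists k : 'I_(size j), A = cell k] >>.

Definition generating J : Prop :=
  directed J /\
  <<s `[0, 1[, \bigcup_(j in J) cell_sigma j >> =
    [set A : set R | measurable A /\ A `<=` `[0, 1[].

(* The filter of tails of the net indexed by [J]. *)
Definition net J : set_system (partition01 R) :=
  [set P | exists j0, J j0 /\ forall j, J j -> refines j0 j -> P j].

Lemma knot_bounds j k : 0 <= knot j k <= 1.
Proof.
case: j => s ps; rewrite /knot [points _]/=.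
have [ks|ks] := ltnP k (size s).+1; last by rewrite nth_default// ler01 lexx.
by rewrite (itv_partition_nth_ge ks ps) (itv_partition_nth_le ks ps).
Qed.

Lemma cell_len_gt0 j (k : 'I_(size j)) : 0 < cell_len k.
Proof.
case: j k => s [/= ps s1] k; rewrite subr_gt0 /knot/=.
exact: (pathP 1 ps).
Qed.

Lemma generating_neq0 J : generating J -> J !=set0.
Proof.
move=> [_ JE]; apply/set0P/eqP => J0.
have : [set A : set R | measurable A /\ A `<=` `[0, 1[] `[0, 2^-1[%classic.
  split; first exact: measurable_itv.
  move=> x /=; rewrite !in_itv/= => /andP[-> x2] /=; lra.
rewrite -JE J0 bigcup_set0 => h.
have [h0|h0] : [set set0; `[0, 1[%classic] (`[0, 2^-1[%classic : set R).
- apply: h; split=> //; split; first by left.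
  + by move=> A [->|->]; [right; rewrite setD0|left; rewrite setDv].
  + move=> F F01; have [[n Fn]|nF] := pselect (exists n, F n = `[0, 1[%classic).
      right; apply/seteqP; split; last by move=> x x01; exists n; rewrite ?Fn.
      by move=> x [m _]; case: (F01 m) => ->.
    left; apply/seteqP; split=> // x [m _]; case: (F01 m) => Fm; rewrite Fm//.
    by exfalso; apply: nF; exists m.
- have : (set0 : set R) 0 by rewrite -h0/= in_itv/= lexx/=; lra.
  by [].
have : (`[0, 1[%classic : set R) 2^-1 by rewrite /= in_itv/=; lra.
by rewrite -h0/= in_itv/= ltxx andbF.
Qed.

Lemma net_proper J : generating J -> ProperFilter (net J).
Proof.
move=> gJ; have [j0 Jj0] := generating_neq0 gJ; have [dJ _] := gJ.
apply: Build_ProperFilter_ex => [P [j [Jj Pj]]|]; first by exists j; exact: Pj.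
split; first by exists j0.
- move=> P Q [j1 [Jj1 Pj1]] [j2 [Jj2 Qj2]].
  have [j3 [Jj3 j13 j23]] := dJ _ _ Jj1 Jj2; exists j3; split=> // j Jj j3j.
  split; first by apply: Pj1 => // x /j13/j3j.
  by apply: Qj2 => // x /j23/j3j.
- by move=> P Q PQ [j [Jj Pj]]; exists j; split=> // j' Jj' jj'; exact/PQ/Pj.
Qed.

End Partitions.

Section Projections.
Context {R : realType} {D : nat}.
Local Notation leb := (@lebesgue_measure R).
Local Notation I := (`[0, 1[%classic : set R).
Local Notation H := (L2 R D).
Implicit Type j : partition01 R.

Definition Hj (j : partition01 R) := {ffun 'I_(size j) -> symmx R D}.

Definition hj_dot j (x y : Hj j) : R := \sum_k cell_len k * sdot (x k) (y k).

Definition conej j : set (Hj j) :=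
  [set x | (forall k, psd (x k)) /\
           (forall k l : 'I_(size j), (k <= l)%N -> psd (x l - x k))].

Definition sintegral_mx (A : set R) (f : R -> symmx R D) : 'M[R]_D :=
  \matrix_(i, l) \int[leb]_(s in A) f s i l.

Lemma sintegral_mx_sym A f :
  [pred M : 'M[R]_D | M \is symmetricmx] (sintegral_mx A f).
Proof.
apply/symmetricmxP/matrixP => i l; rewrite !mxE; apply: eq_Rintegral => s _.
by rewrite -[in RHS](trmx_symmx (f s)) mxE.
Qed.

Definition sintegral A f : symmx R D := Symmx (sintegral_mx_sym A f).

Definition step_fun j (x : Hj j) (s : R) : symmx R D :=
  \sum_k \1_(cell k) s *: x k.

Lemma step_fun_sqint j (x : Hj j) : sqint (step_fun x).
Proof.
suff : step_fun x \in @sqint_pred R D by rewrite inE.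
have -> : step_fun x = \sum_k (fun s => \1_(cell k) s *: x k).
  by apply/funext => s; rewrite fct_sumE.
apply: rpred_sum => k _; rewrite inE/=; split=> [i l|].
  rewrite (_ : (fun s => _) = (fun s => \1_(cell k) s * x k i l)).
    apply: measurable_funM => //; apply: measurable_indic.
    exact: measurable_itv.
  by apply/funext => s; rewrite symmxZ mxE.
apply: (@le_lt_trans _ _ (\int[leb]_(s in I) (cst (`|x k| ^+ 2)%:E s))%E).
  apply: ge0_le_integral => //.
  - apply/measurable_EFinP.
    rewrite (_ : (fun s => _) = (fun s => (\1_(cell k) s) ^+ 2 * `|x k| ^+ 2)).
      apply: measurable_funM => //; apply: measurable_funX.
      by apply: measurable_indic; exact: measurable_itv.
    apply/funext => s; rewrite normrZ exprMn; congr (_ * _).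
    by rewrite ger0_norm.
  - move=> s _; rewrite lee_fin normrZ exprMn ler_piMl// ?sqr_ge0//.
    rewrite indicE; case: (_ \in _); rewrite ?normr1 ?normr0 ?expr1n//.
    by rewrite expr0n.
rewrite integral_cst/=; last exact: measurable_itv.
by rewrite lebesgue_measure_itv/= lte_fin ltr01 oppr0 adde0 mule1 ltry.
Qed.

Definition lj j (x : Hj j) : H := l2_class (mk_sqfun (step_fun_sqint x)).

(* Does not depend on the representative, see [pjE]. *)
Definition pj j (x : H) : Hj j :=
  [ffun k => (cell_len k)^-1 *: sintegral (cell k) (repr x : sqfun R D)].

Definition avg j (x : H) : H := lj (pj j x).

Definition lift_up j (g : R -> Hj j -> \bar R) (t : R) (mu : H) : \bar R :=
  g t (pj j mu).

Lemma cell_subset j (k : 'I_(size j)) : cell k `<=` I.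
Proof.
move=> s; rewrite /cell /= !in_itv/= => /andP[a b].
have /andP[a0 _] := knot_bounds j k; have /andP[_ b1] := knot_bounds j k.+1.
by rewrite (le_trans a0 a) (lt_le_trans b b1).
Qed.

Lemma pjE j (f : sqfun R D) :
  pj j (l2_class f) = [ffun k => (cell_len k)^-1 *: sintegral (cell k) f].
Proof.
have FF := @ae_filter_leb R.
apply/ffunP => k; rewrite !ffunE; congr (_ *: _); apply/val_inj/matrixP => i l.
have mcell : measurable (cell k) by exact: measurable_itv.
rewrite !mxE; congr fine; apply: ae_eq_integral => //.
- apply/measurable_EFinP; apply: measurable_funS (@cell_subset _ k) _ => //.
  by have [] := sqfunP (repr (l2_class f) : sqfun R D).
- apply/measurable_EFinP; apply: measurable_funS (@cell_subset _ k) _ => //.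
  by have [] := sqfunP f.
apply: filterS (l2_repr_class f) => s fs sk.
by rewrite fs//; exact: cell_subset sk.
Qed.

End Projections.
Arguments Hj {R} D j.
Arguments pj {R D} j x.
Arguments avg {R D} j x.

(* Main.v *)
Require Import Defs.
From mathcomp Require Import all_boot all_order all_algebra.
From mathcomp Require Import sesquilinear.
From mathcomp Require Import all_classical all_reals all_analysis measurable_realfun.
From mathcomp Require Import ring lra.
Import Order.TTheory GRing.Theory Num.Theory.
Import numFieldNormedType.Exports.
Set Implicit Arguments.
Unset Strict Implicit.
Unset Printing Implicit Defensive.
Local Open Scope classical_set_scope.
Local Open Scope ring_scope.

(* Duality gives two inequalities. For y in C^j and rho in C, the pairing
   <l_j y, rho> only sees p_j rho, H(rho^(j)) <= H(rho), and mu - mu^(j) lies in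
   C^* by Chebyshev's inequality on each cell; hence f_j(t, p_j mu) <= f(t, mu)
   for every j. Conversely, for nu in C, restricting the infimum over rho to step
   functions bounds it by f_j(t, p_j mu) up to the error
   psi(mu + nu) - psi(mu^(j) + nu^(j)), which tends to 0 because
   mu^(j) -> mu in L^2: a generating collection has mesh tending to 0, and
   |mu(.)|^2 is nondecreasing, so |mu^(j)|^2 dominates a slight left shift of
   |mu|^2 and the norm of mu^(j) tends to that of mu. *)

(** * Traces of products of positive semidefinite matrices *)

Section PsdMatrices.
Context {R : realType}.

Definition psd_mx n (A : 'M[R]_n) := forall v : 'rV[R]_n, 0 <= (v *m A *m v^T) 0 0.

Lemma trace11 (A : 'M[R]_1) : \tr A = A 0 0.
Proof. by rewrite /mxtrace big_ord1. Qed.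

(* By induction on the size: [B] is the sum of a rank-one positive matrix and its
   Schur complement. *)
Lemma psd_mx_trace n (A B : 'M[R]_n) : B^T = B ->
  psd_mx A -> psd_mx B -> 0 <= \tr (A *m B).
Proof.
elim: n A B => [|n IHn] A B; first by rewrite /mxtrace big_ord0.
rewrite -[n.+1]/(1 + n)%N in A B * => Bs pA pB.
pose a := B 0 0.
pose e (x : R) (v : 'rV[R]_n) : 'rV[R]_(1 + n) := row_mx x%:M v.
pose r : 'rV[R]_n := ursubmx B.
pose S : 'M[R]_n := drsubmx B.
have BE : B = block_mx a%:M r r^T S.
  rewrite -[B in LHS]submxK; congr block_mx.
    by rewrite [LHS]mx11_scalar mxE mxE; congr (B _ _)%:M; apply/val_inj.
  by rewrite /r trmx_ursub Bs.
have qB x v : (e x v *m B *m (e x v)^T) 0 0 =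
    x ^+ 2 * a + (x * (r *m v^T) 0 0) *+ 2 + (v *m S *m v^T) 0 0.
  rewrite BE /e mul_row_block tr_row_mx mul_row_col tr_scalar_mx.
  rewrite !mulmxDl -!scalar_mxM !mul_scalar_mx mul_mx_scalar -!scalemxAl.
  have -> : v *m r^T = (r *m v^T)^T by rewrite trmx_mul trmxK.
  by rewrite !mxE eqxx /=; ring.
have a0 : 0 <= a.
  have := pB (e 1 0); rewrite qB trmx0 mulmx0 !mulmx0 !mxE; lra.
have pS : psd_mx S.
  by move=> v; have := pB (e 0 v); rewrite qB; lra.
have pAd : psd_mx (drsubmx A).
  move=> v; have := pA (e 0 v); rewrite -[A in X in X -> _]submxK /e.
  rewrite mul_row_block tr_row_mx mul_row_col tr_scalar_mx.
  by rewrite !mul_mx_scalar !mul_scalar_mx !scale0r !add0r.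
have [az|az] := eqVneq a 0.
  have r0 : r = 0.
    apply/eqP; rewrite -[_ == _]negbK; apply/negP => rn0.
    have rr : 0 < (r *m r^T) 0 0.
      rewrite mxE lt_def; apply/andP; split; last first.
        by apply: sumr_ge0 => i _; rewrite (mxE _ _ i) -expr2 sqr_ge0.
      apply: contra rn0; rewrite psumr_eq0 => [/allP h|i _]; last first.
        by rewrite (mxE _ _ i) -expr2 sqr_ge0.
      apply/eqP/rowP => i; have := h i (mem_index_enum _).
      by rewrite (mxE _ _ i) -expr2 sqrf_eq0 => /eqP ->; rewrite mxE.
    (* With [q = r S r^T >= 0], this first coordinate gives the form of [B] the value [- q - 2], a
       contradiction. *)
    have := pB (e (- ((r *m S *m r^T) 0 0 + 1) / (r *m r^T) 0 0) r).
    rewrite qB az mulr0 add0r mulfVK ?gt_eqF//.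
    have := pS r; lra.
  rewrite BE az r0 -[A]submxK mulmx_block.
  rewrite trmx0 raddf0 !mulmx0 !add0r ?addr0 mxtrace_block raddf0 add0r.
  by apply: IHn => //; rewrite /S trmx_drsub Bs.
have ap : 0 < a by rewrite lt_def az.
pose w := e a r.
pose S' := S - a^-1 *: (r^T *m r).
have BE' : B = a^-1 *: (w^T *m w) + block_mx 0 0 0 S'.
  rewrite BE /w /e tr_row_mx tr_scalar_mx mul_col_row.
  rewrite scale_block_mx add_block_mx !addr0 !mul_scalar_mx !mul_mx_scalar.
  rewrite !scalerA mulVf// !scale1r.
  by rewrite /S' addrC subrK.
have pS' : psd_mx S'.
  (* This first coordinate minimizes the quadratic polynomial [qB] in [x]; the minimum is the form
     of the Schur complement [S'] at [v]. *)
  move=> v; have := pB (e (- (a^-1 * (r *m v^T) 0 0)) v); rewrite qB => h.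
  have -> : (v *m S' *m v^T) 0 0 = (v *m S *m v^T) 0 0 - a^-1 * ((r *m v^T) 0 0) ^+ 2.
    rewrite /S' mulmxBr mulmxBl -scalemxAr -scalemxAl mulmxA.
    have -> : v *m r^T = (r *m v^T)^T by rewrite trmx_mul trmxK.
    rewrite -(mulmxA _ r) [r *m _]mx11_scalar tr_scalar_mx -scalar_mxM.
    by rewrite !mxE eqxx expr2.
  apply: le_trans h _; rewrite le_eqVlt; apply/orP; left; apply/eqP.
  have : a^-1 * a = 1 by rewrite mulVf.
  move: (a^-1) => b ba.
  have -> : (- (b * (r *m v^T) 0 0)) ^+ 2 * a = (b * a) * b * (r *m v^T) 0 0 ^+ 2.
    ring.
  by rewrite ba; ring.
rewrite BE' mulmxDr mxtraceD addr_ge0//.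
  rewrite -scalemxAr mxtraceZ mulr_ge0 ?invr_ge0// mulmxA mxtrace_mulC mulmxA.
  by rewrite trace11.
rewrite -[A]submxK mulmx_block !mulmx0 !add0r ?addr0 mxtrace_block raddf0 add0r.
apply: IHn => //.
by rewrite /S' raddfB /= [X in _ - X = _]linearZ /= trmx_mul trmxK /S trmx_drsub Bs.
Qed.

End PsdMatrices.

(** * The semidefinite order and the Frobenius pairing *)

Section Psd.
Context {R : realType} {D : nat}.
Implicit Types a b c : symmx R D.

Lemma outer_sym (v : 'rV[R]_D) : [pred M : 'M[R]_D | M \is symmetricmx] (v^T *m v).
Proof. by apply/symmetricmxP; rewrite trmx_mul trmxK. Qed.

Definition outer (v : 'rV[R]_D) : symmx R D := Symmx (outer_sym v).

(** The form of [a] at [v] is the trace of [a] against a rank-one matrix, by cyclicity. Positivity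
    thus becomes a family of conditions linear in [a], which pass to averages. *)
Lemma psdP a : psd a <-> forall v, 0 <= sdot a (outer v).
Proof.
have E v : sdot a (outer v) = (v *m a *m v^T) 0 0.
  by rewrite /sdot /= mulmxA mxtrace_mulC mulmxA trace11.
by split=> h v; have := h v; rewrite E.
Qed.

Lemma psd_sdot a b : psd a -> psd b -> 0 <= sdot a b.
Proof. by apply: psd_mx_trace; rewrite trmx_symmx. Qed.

Lemma sdot0l a : sdot 0 a = 0.
Proof. by rewrite -(scale0r (0 : symmx R D)) sdotZl mul0r. Qed.

Lemma sdotDr a b c : sdot a (b + c) = sdot a b + sdot a c.
Proof. by rewrite !(sdotC a) sdotDl. Qed.

Lemma sdotZr (l : R) a b : sdot a (l *: b) = l * sdot a b.
Proof. by rewrite !(sdotC a) sdotZl. Qed.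

Lemma sdotBl a b c : sdot (a - b) c = sdot a c - sdot b c.
Proof. by rewrite -scaleN1r sdotDl sdotZl mulN1r. Qed.

Lemma sdotBr a b c : sdot a (b - c) = sdot a b - sdot a c.
Proof. by rewrite !(sdotC a) sdotBl. Qed.

Lemma psd0 : psd (0 : symmx R D).
Proof. by apply/psdP => v; rewrite sdot0l. Qed.

Lemma psdD a b : psd a -> psd b -> psd (a + b).
Proof.
by move=> /psdP pa /psdP pb; apply/psdP => v; rewrite sdotDl addr_ge0.
Qed.

(** The difference of the squared norms is the pairing of [a - b] with [a + b], both positive
    semidefinite. *)
Lemma psd_sqr_le a b : psd b -> psd (a - b) -> sdot b b <= sdot a a.
Proof.
move=> pb pab; have pa : psd a by rewrite -(subrK b a); exact: psdD.
have := psd_sdot pab (psdD pa pb).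
by rewrite sdotBl !sdotDr (sdotC b a); lra.
Qed.

End Psd.

(** * Combinatorics of knots and cells *)

Section Cells.
Context {R : realType}.
Implicit Type j : partition01 R.

Lemma knot0 j : knot j 0 = 0.
Proof. by []. Qed.

Lemma knot_size j : knot j (size j) = 1.
Proof.
have [_ /eqP] : itv_partition 0 1 (points j) by case: j.
rewrite /knot -[_ (size j)]/(nth 1 (0 :: points j) (size (0 :: points j)).-1).
by rewrite nth_last.
Qed.

Lemma knot_le j k l : (k <= l)%N -> knot j k <= knot j l.
Proof.
elim: l => [|m ih]; first by rewrite leqn0 => /eqP ->.
rewrite leq_eqVlt ltnS => /predU1P[->//|/ih /le_trans]; apply.
have [ms|ms] := ltnP m (size j).
  by have := @cell_len_gt0 _ j (Ordinal ms); rewrite subr_gt0 => /ltW.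
(* Past the last knot, [nth] returns its default [1], the maximal value of a knot. *)
have -> : knot j m.+1 = 1 by rewrite /knot nth_default.
by have /andP[] := knot_bounds j m.
Qed.

Lemma measurable_cell j (k : 'I_(size j)) :
  measurable (cell k : set (measurableTypeR R)).
Proof. exact: measurable_itv. Qed.

Lemma cell_cover j s : 0 <= s < 1 -> exists k : 'I_(size j), cell k s.
Proof.
move=> /andP[s0 s1].
have : forall m, (m <= size j)%N -> s < knot j m ->
    exists k : 'I_(size j), cell k s.
  elim=> [_|m ih mj sm]; first by rewrite knot0 ltNge s0.
  have [ms|ms] := leP (knot j m) s; last exact: ih (ltnW mj) ms.
  by exists (Ordinal mj); rewrite /cell/= in_itv/= ms.
by apply; [exact: leqnn|rewrite knot_size].
Qed.

Lemma cell_mono j (k l : 'I_(size j)) s t :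
  cell k s -> cell l t -> s <= t -> (k <= l)%N.
Proof.
rewrite /cell/= !in_itv/= => /andP[ks sk] /andP[lt tl] st.
rewrite leqNgt; apply/negP => lk.
have := le_lt_trans (le_trans (knot_le j lk) ks) (le_lt_trans st tl).
by rewrite ltxx.
Qed.

Lemma cell_inj j (k l : 'I_(size j)) s : cell k s -> cell l s -> k = l.
Proof.
move=> ks ls; apply/val_inj/eqP; rewrite eqn_leq.
by rewrite (cell_mono ks ls)// (cell_mono ls ks).
Qed.

Lemma points_not_in_cell j (k : 'I_(size j)) p :
  p \in points j -> ~ (knot j k < p < knot j k.+1).
Proof.
(* [knot] prepends [t_0 = 0], which shifts the index of a point by one. *)
move=> pj; have <- : knot j (index p j).+1 = p by rewrite /knot/= nth_index.
move: (index _ _).+1 => m; have [/(knot_le j)|/(knot_le j)] := leqP m k.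
  by move=> /le_gtF ->.
by move=> /le_gtF ->; rewrite andbF.
Qed.

Lemma measure_cell j (k : 'I_(size j)) :
  fine (@lebesgue_measure R (cell k)) = cell_len k.
Proof.
have := cell_len_gt0 k; rewrite subr_gt0 => kk.
by rewrite /cell lebesgue_measure_itv/= lte_fin kk -EFinD.
Qed.

End Cells.

(** * Matrix-valued integrals, step functions and cell means *)

Section Integrals.
Context {R : realType} {D : nat}.
Local Notation leb := (@lebesgue_measure R).
Local Notation I := (`[0, 1[%classic : set R).
Implicit Type j : partition01 R.

Lemma Rintegral_sum (T : Type) (s : seq T) (A : set R) (F : T -> R -> R) :
  measurable A -> (forall i, leb.-integrable A (EFin \o F i)) ->
  \int[leb]_(x in A) (\sum_(i <- s) F i x) =
  \sum_(i <- s) \int[leb]_(x in A) F i x.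
Proof.
move=> mA iF; elim: s => [|i s ih].
  rewrite big_nil -[RHS](mul0r (fine (leb A))) -Rintegral_cst//.
  by apply: eq_Rintegral => x _; rewrite big_nil.
rewrite big_cons -ih -RintegralD//.
  by apply: eq_Rintegral => x _; rewrite big_cons.
rewrite (_ : _ \o _ = (fun x => \sum_(i <- s) (F i x)%:E)%E).
  by apply: integrable_sum => // ? _; exact: iF.
by apply/funext => x /=; rewrite sumEFin.
Qed.

(** Empty intervals are allowed: the lemma serves for the knots and also for their left shifts
    clipped at [0]. *)
Lemma Rintegral_itv_split (t : nat -> R) (g : R -> R) m :
  (forall k, t k <= t k.+1) ->
  leb.-integrable `[t 0%N, t m[ (EFin \o g) ->
  \int[leb]_(s in `[t 0%N, t m[) g s =
  \sum_(k < m) \int[leb]_(s in `[t k, t k.+1[) g s.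
Proof.
move=> tS; have t0 k : t 0%N <= t k by elim: k => // k /le_trans; exact.
elim: m => [_|m ih ig].
  by rewrite big_ord0 set_itv_ge ?bnd_simp ?ltxx// Rintegral_set0.
have E : `[t 0%N, t m.+1[%classic = `[t 0%N, t m[ `|` `[t m, t m.+1[.
  by apply: itv_bndbnd_setU; rewrite bnd_simp.
have ig' : leb.-integrable `[t 0%N, t m[ (EFin \o g).
  by apply: integrableS ig => //; rewrite E; exact: subsetUl.
rewrite big_ord_recr/= -ih// E Rintegral_setU// -?E//.
apply/disj_setPS => s /= [].
by rewrite !in_itv/= => /andP[_ sm] /andP[]; rewrite leNgt sm.
Qed.

Lemma Rintegral_cells j (g : R -> R) : leb.-integrable I (EFin \o g) ->
  \int[leb]_(s in I) g s = \sum_(k < size j) \int[leb]_(s in cell k) g s.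
Proof.
move=> ig; have := @Rintegral_itv_split (knot j) g (size j).
by rewrite knot0 knot_size; apply=> // k; exact: knot_le.
Qed.

(** The interval has finite measure, and [|x| <= 1 + x^2], where the square of an entry is at most
    the squared Frobenius norm. *)
Lemma integrable_entry (f : sqfun R D) i l :
  leb.-integrable I (EFin \o (fun s => f s i l)).
Proof.
have [mf _] := sqfunP f.
have : leb.-integrable I (fun s => (cst 1%:E s + (sdot (f s) (f s))%:E)%E).
  apply: integrableD => //; last exact: integrable_sdot.
  apply/integrableP; split; first exact: measurable_cst.
  rewrite integral_cst//= lebesgue_measure_itv/= lte_fin ltr01 normr1 -EFinB.
  by rewrite -EFinM ltry.
apply: le_integrable => //; first by apply/measurable_EFinP; exact: mf.
move=> s _ /=; rewrite lee_fin.
have h : (f s i l) ^+ 2 <= sdot (f s) (f s).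
  rewrite sdotE (bigD1 i)//= (bigD1 l)//= -expr2 -addrA lerDl addr_ge0//.
    by apply: sumr_ge0 => ? _; rewrite -expr2 sqr_ge0.
  by do 2!apply: sumr_ge0 => ? _; rewrite -expr2 sqr_ge0.
rewrite [leRHS]ger0_norm ?addr_ge0 ?sdot_ge0//.
by have := sqr_ge0 (f s i l); rewrite ler_norml; nra.
Qed.

Lemma integrable_sdot_cst (A : set R) (f : sqfun R D) (a : symmx R D) :
  measurable A -> A `<=` I -> leb.-integrable A (fun s => (sdot (f s) a)%:E).
Proof.
move=> mA AI.
have ie i l : leb.-integrable A (EFin \o (fun s => f s i l)).
  exact: integrableS (integrable_entry f i l).
rewrite (_ : (fun _ => _) =
    (fun s => \sum_i \sum_l (a i l)%:E * (f s i l)%:E)%E).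
  by do 2!apply: integrable_sum => // ? _; apply: integrableZl => //; exact: ie.
apply/funext => s; rewrite sdotE -sumEFin; apply: eq_bigr => i _.
by rewrite -sumEFin; apply: eq_bigr => l _; rewrite mulrC EFinM.
Qed.

Lemma sdot_sintegral (A : set R) (f : sqfun R D) (a : symmx R D) :
  measurable A -> A `<=` I ->
  sdot (Defs.sintegral A f) a = \int[leb]_(s in A) sdot (f s) a.
Proof.
move=> mA AI.
have ie i l : leb.-integrable A (EFin \o (fun s => f s i l)).
  exact: integrableS (integrable_entry f i l).
have ie' i l : leb.-integrable A (EFin \o (fun s => f s i l * a i l)).
  rewrite (_ : _ \o _ = (fun s => (a i l)%:E * (f s i l)%:E)%E).
    by apply: integrableZl => //; exact: ie.
  by apply/funext => s /=; rewrite mulrC EFinM.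
under eq_Rintegral do rewrite sdotE.
rewrite Rintegral_sum//; last first.
  move=> i; rewrite (_ : _ \o _ = (fun s => \sum_l (f s i l * a i l)%:E)%E).
    by apply: integrable_sum => // ? _; exact: ie'.
  by apply/funext => s /=; rewrite sumEFin.
rewrite sdotE; apply: eq_bigr => i _; rewrite Rintegral_sum//.
by apply: eq_bigr => l _; rewrite mxE RintegralZr.
Qed.

Lemma step_fun_cell j (x : Hj D j) k s : cell k s -> step_fun x s = x k.
Proof.
move=> ks; rewrite /step_fun (bigD1 k)//= big1 ?addr0 => [|l lk].
  by rewrite indicE mem_set// scale1r.
rewrite indicE memNset ?scale0r// => ls.
by move: lk; rewrite (cell_inj ls ks) eqxx.
Qed.

Lemma sdot_pj j (f : sqfun R D) k (a : symmx R D) :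
  sdot (pj j (l2_class f) k) a =
  (cell_len k)^-1 * \int[leb]_(s in cell k) sdot (f s) a.
Proof.
rewrite pjE ffunE sdotZl sdot_sintegral//; last exact: cell_subset.
exact: measurable_cell.
Qed.

Lemma pjK j (x : Hj D j) : pj j (lj x) = x.
Proof.
apply/ffunP => k; rewrite pjE ffunE; apply/val_inj/matrixP => i l.
rewrite /= !mxE (@eq_Rintegral _ _ _ _ _ (cst (x k i l))); last first.
  by move=> s /set_mem sk /=; rewrite (step_fun_cell x sk).
rewrite Rintegral_cst ?measure_cell; last exact: measurable_cell.
by rewrite mulrC mulfK// gt_eqF// cell_len_gt0.
Qed.

(** [lj] and [pj] are adjoint: a step function is constant on each cell, so it pairs only with the
    mean of [y] there. *)
Lemma l2_dot_lj j (x : Hj D j) (y : L2 R D) :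
  l2_dot (lj x) y = hj_dot x (pj j y).
Proof.
rewrite -(l2_reprK y); move: (repr y : sqfun R D) => f.
rewrite l2_dotE (Rintegral_cells j); last exact: integrable_sdot.
apply: eq_bigr => k _; rewrite [in RHS]sdotC sdot_pj mulVKf; last first.
  by rewrite gt_eqF// cell_len_gt0.
by apply: eq_Rintegral => s /set_mem sk; rewrite /= (step_fun_cell x sk) sdotC.
Qed.

Lemma ljD j (x y : Hj D j) : lj (x + y) = lj x + lj y.
Proof.
rewrite /lj -l2_classD; congr l2_class; apply/val_inj/funext => s /=.
rewrite /step_fun -[RHS]/(_ + _) -big_split/=; apply: eq_bigr => k _.
by rewrite ffunE scalerDr.
Qed.

End Integrals.

(** * Chebyshev's inequality and the cones under projection and lifting *)

Section ConeProjections.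
Context {R : realType} {D : nat}.
Local Notation leb := (@lebesgue_measure R).
Local Notation I := (`[0, 1[%classic : set R).
Implicit Type j : partition01 R.

Lemma integrable_cell_cst j (k : 'I_(size j)) (c : R) :
  leb.-integrable (cell k) (EFin \o cst c).
Proof.
apply/integrableP; split; first by apply/measurable_EFinP; exact: measurable_cst.
rewrite (eq_integral (cst `|c|%:E))//= integral_cst/=; last exact: measurable_cell.
have := cell_len_gt0 k; rewrite subr_gt0 => kk.
by rewrite /cell lebesgue_measure_itv/= lte_fin kk -EFinB -EFinM ltry.
Qed.

(** Both integrations in Chebyshev's inequality have this shape: [a = 1] for the one over [s],
    [a = cell_len k] for the one over [r]. *)
Lemma Rintegral_affine j (k : 'I_(size j)) (c a : R) (u v w : R -> R) :
  leb.-integrable (cell k) (EFin \o u) -> leb.-integrable (cell k) (EFin \o v) ->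
  leb.-integrable (cell k) (EFin \o w) ->
  \int[leb]_(s in cell k) (c - u s - v s + a * w s) =
  c * cell_len k - \int[leb]_(s in cell k) u s - \int[leb]_(s in cell k) v s +
  a * \int[leb]_(s in cell k) w s.
Proof.
move=> iu iv iw; have mk := measurable_cell k; have ic := integrable_cell_cst k c.
have icu : leb.-integrable (cell k) (EFin \o (fun s => c - u s)).
  exact: (integrableB _ ic iu).
have icuv : leb.-integrable (cell k) (EFin \o (fun s => c - u s - v s)).
  exact: (integrableB _ icu iv).
rewrite RintegralD ?RintegralB ?RintegralZl ?Rintegral_cst ?measure_cell//.
exact: (integrableZl _ a iw).
Qed.

(* Chebyshev's inequality: integrate [(f s - f r) . (g s - g r) >= 0] over [s],
   then over [r]. *)
Lemma sdot_sintegral_le j (k : 'I_(size j)) (f g : sqfun R D) :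
  psd_increasing f -> psd_increasing g ->
  sdot (Defs.sintegral (cell k) f) (Defs.sintegral (cell k) g) <=
  cell_len k * \int[leb]_(s in cell k) sdot (f s) (g s).
Proof.
move=> fi gi; have mk := measurable_cell k; have kI := @cell_subset _ j k.
have L0 := cell_len_gt0 k.
set F := Defs.sintegral _ f; set G := Defs.sintegral _ g; set P := Rintegral _ _ _.
have ifg : leb.-integrable (cell k) (EFin \o (fun s => sdot (f s) (g s))).
  exact: (@integrableS _ _ _ leb _ _ _ (measurable_itv _) mk kI (integrable_sdot f g)).
have pos r : cell k r ->
    0 <= P - sdot (f r) G - sdot (g r) F + cell_len k * sdot (f r) (g r).
  move=> kr.
  have := @Rintegral_affine j k (sdot (f r) (g r)) 1 (fun s => sdot (f s) (g r))
    (fun s => sdot (g s) (f r)) (fun s => sdot (f s) (g s)).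
  move=> /(_ (integrable_sdot_cst f _ mk kI) (integrable_sdot_cst g _ mk kI) ifg).
  rewrite -!sdot_sintegral// -/F -/G -/P => E.
  rewrite (_ : _ + _ = \int[leb]_(s in cell k) (sdot (f r) (g r) -
      sdot (f s) (g r) - sdot (g s) (f r) + 1 * sdot (f s) (g s))); last first.
    by rewrite E (sdotC F) (sdotC G); ring.
  apply: Rintegral_ge0 => s ks.
  rewrite (_ : _ + _ = sdot (f s - f r) (g s - g r)); last first.
    by rewrite !(sdotBl, sdotBr) (sdotC (g s)); ring.
  move: (kI _ ks) (kI _ kr); rewrite /= !in_itv/= => /andP[s0 s1] /andP[r0 r1].
  (* Exchanging [r] and [s] negates both increments and leaves their pairing unchanged. *)
  have [rs|sr] := leP r s; first by apply: psd_sdot; [exact: fi|exact: gi].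
  rewrite (_ : sdot _ _ = sdot (f r - f s) (g r - g s)).
    by apply: psd_sdot; [apply: fi => //; exact: ltW|apply: gi => //; exact: ltW].
  by rewrite !(sdotBl, sdotBr); ring.
(* Integrating over [r] yields [2 L P - 2 F.G >= 0], where [L] is the cell length. *)
have := @Rintegral_ge0 _ _ _ leb _ _ pos.
rewrite Rintegral_affine// -?sdot_sintegral//; try exact: integrable_sdot_cst.
by rewrite (sdotC G) -/F -/G -/P; lra.
Qed.

Lemma hj_dot_le_l2_dot j (x y : L2 R D) : cone x -> cone y ->
  hj_dot (pj j x) (pj j y) <= l2_dot x y.
Proof.
move=> [f [_ _ fi] <-] [g [_ _ gi] <-].
rewrite l2_dotE (Rintegral_cells j); last exact: integrable_sdot.
apply: ler_sum => k _; have L0 := cell_len_gt0 k.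
rewrite !pjE !ffunE sdotZl sdotZr !mulrA mulfV ?mul1r; last by rewrite gt_eqF.
by rewrite ler_pdivrMl// sdot_sintegral_le.
Qed.

(** By adjointness, pairing [avg j mu] with [kappa] amounts to pairing their projections, so
    Chebyshev's inequality summed over the cells applies. *)
Lemma dual_cone_avg j (mu : L2 R D) : cone mu -> dual_cone (mu - avg j mu).
Proof.
move=> mu_cone kappa k_cone.
rewrite -scaleN1r l2_dotDl l2_dotZl mulN1r subr_ge0 l2_dot_lj.
exact: hj_dot_le_l2_dot.
Qed.

(** Taken with [a = outer v] for all [v], this scalar bound carries the semidefinite order over to
    cell means. *)
Lemma le_sdot_pj j (f : sqfun R D) k (a : symmx R D) c :
  (forall s, cell k s -> c <= sdot (f s) a) -> c <= sdot (pj j (l2_class f) k) a.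
Proof.
move=> h; rewrite sdot_pj ler_pdivlMl ?cell_len_gt0// mulrC -measure_cell.
have mk := measurable_cell k.
rewrite -Rintegral_cst//; apply: le_Rintegral => //.
  exact: integrable_cell_cst.
by apply: integrable_sdot_cst => //; exact: cell_subset.
Qed.

Lemma sdot_pj_le j (f : sqfun R D) k (a : symmx R D) c :
  (forall s, cell k s -> sdot (f s) a <= c) -> sdot (pj j (l2_class f) k) a <= c.
Proof.
move=> h; have sdotNr b : sdot b (- a) = - sdot b a.
  by rewrite -(scaleN1r a) sdotZr mulN1r.
have := @le_sdot_pj j f k (- a) (- c); rewrite sdotNr lerN2; apply=> s ks.
by rewrite sdotNr lerN2; exact: h.
Qed.

Lemma cell_knot j (k : 'I_(size j)) : cell k (knot j k).
Proof. by rewrite /cell /= in_itv/= lexx/= -subr_gt0; exact: cell_len_gt0. Qed.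

Lemma psd_le_pj j (f : sqfun R D) k : psd_increasing f ->
  psd (pj j (l2_class f) k - f (knot j k)).
Proof.
move=> fi; apply/psdP => v; rewrite sdotBl subr_ge0; apply: le_sdot_pj => s ks.
rewrite -subr_ge0 -sdotBl; move: v; apply/psdP; apply: fi.
- by have /andP[] := knot_bounds j k.
- by move: ks; rewrite /cell/= in_itv/= => /andP[].
- by have := cell_subset ks; rewrite /= in_itv/= => /andP[].
Qed.

Lemma conej_pj j (x : L2 R D) : cone x -> conej (pj j x).
Proof.
move=> [f [f0 _ fi] <-]; split=> [k|k l].
  apply/psdP => v; apply: le_sdot_pj => s /cell_subset; rewrite /= in_itv => sI.
  by move: v; apply/psdP; exact: f0.
rewrite leq_eqVlt => /predU1P[/val_inj ->|kl]; first by rewrite subrr; exact: psd0.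
(* For [k < l], the value of [f] at the left end of cell [l] lies between the two means. *)
rewrite -(subrK (f (knot j l)) (pj j _ l)) -addrA; apply: psdD.
  exact: psd_le_pj.
apply/psdP => v; rewrite sdotBl subr_ge0; apply: sdot_pj_le => s ks.
rewrite -subr_ge0 -sdotBl; move: v; apply/psdP; apply: fi.
- by have := cell_subset ks; rewrite /= in_itv/= => /andP[].
- move: ks; rewrite /cell/= in_itv/= => /andP[_ /ltW /le_trans]; apply.
  exact: knot_le.
- by have := cell_subset (cell_knot l); rewrite /= in_itv/= => /andP[].
Qed.

(** With the right end included instead of the left one, points just left of [t] share its cell even
    if [t] is a knot; this gives the left limits of step functions. *)
Lemma cell_cover_left j (t : R) : 0 < t <= 1 ->
  exists k : 'I_(size j), knot j k < t <= knot j k.+1.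
Proof.
move=> /andP[t0 t1].
have : forall m, (m <= size j)%N -> t <= knot j m ->
    exists k : 'I_(size j), knot j k < t <= knot j k.+1.
  elim=> [_|m ih mj tm]; first by rewrite knot0 leNgt t0.
  have [mt|mt] := ltP (knot j m) t; last exact: ih (ltnW mj) mt.
  by exists (Ordinal mj); rewrite mt.
by apply; [exact: leqnn|rewrite knot_size].
Qed.

Lemma cadlag_step_fun j (x : Hj D j) : cadlag (step_fun x).
Proof.
split=> [t t01|t /andP[t0 t1]].
  have [k tk] := cell_cover j t01; rewrite (step_fun_cell x tk).
  apply: cvg_near_cst; move: tk; rewrite /cell/= in_itv/= => /andP[kt tk].
  near=> s; apply: step_fun_cell; rewrite /cell/= in_itv/=; apply/andP; split.
    by apply: (le_trans kt); near: s; exact: nbhs_right_ge.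
  by near: s; exact: nbhs_right_lt.
have [|k /andP[kt tk]] := @cell_cover_left j t; first by rewrite t0 ltW.
apply/cvg_ex; exists (x k); apply: cvg_near_cst.
near=> s; apply: step_fun_cell; rewrite /cell/= in_itv/=; apply/andP; split.
  by near: s; exact: nbhs_left_ge.
by apply: lt_le_trans tk; near: s; exact: nbhs_left_lt.
Unshelve. all: by end_near. Qed.

Lemma cone_lj j (x : Hj D j) : conej x -> cone (lj x).
Proof.
move=> [x0 xi]; exists (mk_sqfun (step_fun_sqint x)) => //; split=> /=.
- by move=> s /(cell_cover j)[k /(step_fun_cell x) ->]; exact: x0.
- exact: cadlag_step_fun.
move=> s t s0 st t1.
have [|k ks] := @cell_cover _ j s; first by rewrite s0 (le_lt_trans st).
have [|l lt] := @cell_cover _ j t; first by rewrite t1 (le_trans s0).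
rewrite (step_fun_cell x ks) (step_fun_cell x lt); apply: xi.
exact: cell_mono ks lt st.
Qed.

Lemma coneD (x y : L2 R D) : cone x -> cone y -> cone (x + y).
Proof.
move=> [f [f0 [fr fl] fi] <-] [g [g0 [gr gl] gi] <-].
exists (f + g); last exact: l2_classD.
split.
- by move=> s s01; apply: psdD; [exact: f0|exact: g0].
- split=> t t01; first by apply: cvgD; [exact: fr|exact: gr].
  by apply: is_cvgD; [exact: fl|exact: gl].
- move=> s t s0 st t1.
  rewrite (_ : _ - _ = (f t - f s) + (g t - g s)).
    by apply: psdD; [exact: fi|exact: gi].
  change (f t + g t - (f s + g s) = f t - f s + (g t - g s)).
  by rewrite opprD addrACA.
Qed.

Lemma cone_avg j (x : L2 R D) : cone x -> cone (avg j x).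
Proof. by move=> /(conej_pj j)/cone_lj. Qed.

End ConeProjections.

(** * Generating collections have mesh tending to zero *)

Section Mesh.
Context {R : realType}.
Implicit Types (j : partition01 R) (J : set (partition01 R)).

Lemma knot_points j m : (0 < m <= size j)%N -> knot j m \in points j.
Proof. by case: m => [//|m] /= mj; exact: mem_nth. Qed.

(* If no knot lay in [(a, b)], no member of the generated sigma-algebra would
   separate two points of [(a, b)]. *)
Lemma generating_dense J (a b : R) : generating J -> 0 <= a -> a < b -> b <= 1 ->
  exists j p, [/\ J j, p \in points j & a < p < b].
Proof.
move=> [_ JE] a0 ab b1; apply: contrapT => nJ.
have N j m : J j -> (m <= size j)%N -> ~~ (a < knot j m < b).
  move=> Jj mj; apply/negP => ajb; have [m0|m0] := posnP m.
    by move: ajb; rewrite m0 knot0 ltNge a0.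
  by apply: nJ; exists j, (knot j m); split=> //; apply: knot_points; rewrite m0.
pose G := [set A : set R | forall s t, a < s < b -> a < t < b -> A s -> A t].
have saG : sigma_algebra `[0, 1[ G.
  split=> [s t _ _ //|A GA s t sab tab [_ nAs]|F GF s t sab tab [n _ Fs]].
  - split; last by move=> /(GA _ _ tab sab).
    move: tab => /andP[at_ tb]; rewrite /= in_itv/= (le_trans a0 (ltW at_)).
    by rewrite (lt_le_trans tb b1).
  - by exists n => //; exact: (GF n s t).
have cG j : J j -> cell_sigma j `<=` G.
  move=> Jj; apply: smallest_sub => // A [k ->] s t /andP[as_ sb] /andP[at_ tb].
  rewrite /cell/= !in_itv/= => /andP[ks sk]; apply/andP; split.
    have := N j k Jj (ltnW (ltn_ord k)); rewrite negb_and -!leNgt.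
    move=> /orP[ka|bk]; first exact: le_trans ka (ltW at_).
    by have := le_lt_trans (le_trans bk ks) sb; rewrite ltxx.
  have := N j k.+1 Jj (ltn_ord k); rewrite negb_and -!leNgt.
  move=> /orP[ka|bk]; last exact: lt_le_trans tb bk.
  by have := lt_trans as_ (lt_le_trans sk ka); rewrite ltxx.
have : [set A : set R | measurable A /\ A `<=` `[0, 1[] `[0, (a + b) / 2[%classic.
  split; first exact: measurable_itv.
  by move=> x /=; rewrite !in_itv/= => /andP[-> xc]/=; lra.
rewrite -JE => /(_ G) h.
have {}h : G `[0, (a + b) / 2[%classic.
  by apply: h; split=> // A [j Jj]; exact: cG.
(* Both points lie in [(a, b)], but only the first lies in [[0, (a + b) / 2)]. *)
have := h ((3 * a + b) / 4) ((a + b) / 2); rewrite /= !in_itv/= ltxx andbF => h'.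
by suff : false by []; apply: h'; lra.
Qed.

(** Cut [[0, 1]] into [M] grid intervals of length below [d / 2]. By directedness one member of [J]
    has a point inside each of them; in a refinement, a cell longer than [d] would contain a whole
    grid interval, hence a knot. *)
Lemma generating_mesh J (d : R) : generating J -> 0 < d ->
  exists j0, J j0 /\ forall j, refines j0 j -> forall k : 'I_(size j), cell_len k <= d.
Proof.
move=> gJ d0; pose M := (Num.truncn (2 / d)).+1.
have M0 : 0 < M%:R :> R by rewrite ltr0n.
have Md : 2 / M%:R < d by rewrite ltr_pdivrMr// mulrC -ltr_pdivrMr//; exact: truncnS_gt.
have : forall m, (m <= M)%N -> exists j, J j /\ forall i, (i < m)%N ->
    exists2 p, p \in points j & i%:R / M%:R < p < i.+1%:R / M%:R.
  elim=> [_|m ih mM].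
    by have [j Jj] := generating_neq0 gJ; exists j; split.
  have [j1 [Jj1 h1]] := ih (ltnW mM).
  have [||| j2 [p [Jj2 pj2 hp]]] :=
    @generating_dense J (m%:R / M%:R) (m.+1%:R / M%:R) gJ.
  - by rewrite divr_ge0.
  - by rewrite ltr_pM2r ?invr_gt0// ltr_nat.
  - by rewrite ler_pdivrMr// mul1r ler_nat.
  have [dJ _] := gJ; have [j3 [Jj3 j13 j23]] := dJ _ _ Jj1 Jj2.
  exists j3; split=> // i; rewrite ltnS leq_eqVlt => /predU1P[->|im].
    by exists p => //; exact: j23.
  by have [q qj1 hq] := h1 _ im; exists q => //; exact: j13.
move=> /(_ M (leqnn M))[j0 [Jj0 h0]]; exists j0; split=> // j j0j k.
rewrite leNgt; apply/negP => dk.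
have /andP[k0 _] := knot_bounds j k; have /andP[_ k1] := knot_bounds j k.+1.
(* Grid interval [i] contains the left end of the cell; the next one lies inside the cell because
   [2 / M < d]. *)
pose i := Num.truncn (knot j k * M%:R).
have /andP[ik ki] : i%:R <= knot j k * M%:R < i.+1%:R.
  by apply: truncn_itv; rewrite mulr_ge0.
have hk : i.+2%:R / M%:R < knot j k.+1.
  have : i%:R / M%:R <= knot j k by rewrite ler_pdivrMr.
  rewrite -addn2 natrD mulrDl; move: dk Md; rewrite /cell_len; lra.
have iM : (i.+1 < M)%N.
  rewrite -(ltr_nat R); move: (lt_le_trans hk k1).
  by rewrite ltr_pdivrMr// mul1r => /le_lt_trans; apply; rewrite ler_nat.
have [p /j0j pj /andP[ip pi]] := h0 _ iM.
apply: (@points_not_in_cell _ j k p pj); apply/andP; split.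
  by apply: lt_trans ip; rewrite ltr_pdivlMr.
exact: lt_trans hk.
Qed.

End Mesh.

(** * Convergence of the averages in norm *)

Section Convergence.
Context {R : realType} {D : nat}.
Local Notation leb := (@lebesgue_measure R).
Local Notation I := (`[0, 1[%classic : set R).
Implicit Type j : partition01 R.

(** Pythagoras' identity for the orthogonal projection [avg j]; it reduces the convergence of
    [avg j x] to that of its norm. *)
Lemma l2_dot_sub_avg j (x : L2 R D) :
  l2_dot (x - avg j x) (x - avg j x) = l2_dot x x - hj_dot (pj j x) (pj j x).
Proof.
have E : l2_dot (avg j x) x = hj_dot (pj j x) (pj j x) by rewrite l2_dot_lj.
have E' : l2_dot (avg j x) (avg j x) = hj_dot (pj j x) (pj j x).
  by rewrite l2_dot_lj pjK.
rewrite -scaleN1r l2_dotDl l2_dotZl !(l2_dotC _ (_ + _)) !l2_dotDl !l2_dotZl.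
by rewrite (l2_dotC x) E E'; ring.
Qed.

(* The integral over [0, 1 - d) is cut at the knots shifted left by [d]: there
   [s] lies to the left of [knot j k], so [f s <= f (knot j k) <= pj j f k]. *)
Lemma le_hj_dot_pj j (d : R) (f : sqfun R D) : 0 < d < 1 ->
  (forall k : 'I_(size j), cell_len k <= d) ->
  (forall s, 0 <= s < 1 -> psd (f s)) -> psd_increasing f ->
  \int[leb]_(s in `[0, 1 - d[) sdot (f s) (f s) <=
  hj_dot (pj j (l2_class f)) (pj j (l2_class f)).
Proof.
move=> /andP[d0 d1] mesh f0 fi.
(* Clipping at [0] makes the shifted knots run from [0] to [1 - d]; the first intervals may be
   empty. *)
pose t k := Num.max 0 (knot j k - d).
have t0 : t 0%N = 0 by rewrite /t max_l// knot0 sub0r oppr_le0 ltW.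
have tn : t (size j) = 1 - d.
  by rewrite /t max_r knot_size// subr_ge0 ltW.
have t_ge0 k : 0 <= t k by rewrite le_max lexx.
have t_lt1 k : t k < 1.
  rewrite gt_max ltr01/= ltrBlDr.
  by have /andP[_ /le_lt_trans] := knot_bounds j k; apply; rewrite ltrDl.
have tS k : t k <= t k.+1.
  by rewrite le_max2// lerB// knot_le.
have iff : leb.-integrable I (EFin \o (fun s => sdot (f s) (f s))).
  exact: integrable_sdot.
have sub a b : 0 <= a -> b <= 1 -> (`[a, b[ : set R) `<=` I.
  move=> a0 b1 s /=; rewrite !in_itv/= => /andP[as_ sb].
  by rewrite (le_trans a0)//= (lt_le_trans sb).
rewrite -{1}t0 -tn Rintegral_itv_split//; last first.
  rewrite t0 tn; apply: (@integrableS _ _ _ leb _ _ _ (measurable_itv _)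
      (measurable_itv _) _ iff).
  by apply: sub => //; rewrite gerBl ltW.
apply: ler_sum => k _; set p := pj j _ k; have p0 := sdot_ge0 p.
(* Clipping does not increase distances. *)
have tk : t k.+1 - t k <= cell_len k.
  rewrite /t /cell_len.
  have kk : knot j k <= knot j k.+1 by apply: knot_le.
  by case: (leP 0 (knot j k - d)); case: (leP 0 (knot j k.+1 - d)); lra.
apply: (@le_trans _ _ (\int[leb]_(s in `[t k, t k.+1[) cst (sdot p p) s)).
  apply: le_Rintegral => //.
  - apply: (@integrableS _ _ _ leb _ _ _ (measurable_itv _)
      (measurable_itv _) _ iff).
    by apply: sub => //; exact: ltW.
  - apply/integrableP; split; first by apply/measurable_EFinP; exact: measurable_cst.
    rewrite (eq_integral (cst `|sdot p p|%:E))//= integral_cst//=.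
    rewrite lebesgue_measure_itv/=; case: ifP => _; last by rewrite mule0 ltry.
    by rewrite -EFinB -EFinM ltry.
  move=> s; rewrite /= in_itv/= => /andP[ts st].
  have s0 : 0 <= s by exact: le_trans ts.
  (* Here [t k.+1 > 0], so it equals [knot j k.+1 - d], which the mesh bound places at or left of
     [knot j k]. *)
  have sk : s <= knot j k.
    move: st; rewrite lt_max ltNge s0/= => /ltW sk.
    by apply: le_trans sk _; rewrite lerBlDl -lerBlDr; exact: mesh.
  have := cell_subset (cell_knot k); rewrite /= in_itv/= => /andP[k0 k1].
  apply: (@le_trans _ _ (sdot (f (knot j k)) (f (knot j k)))).
    by apply: psd_sqr_le; [apply: f0; rewrite s0 (le_lt_trans sk)|exact: fi].
  by apply: psd_sqr_le; [apply: f0; rewrite k0|exact: psd_le_pj].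
rewrite Rintegral_cst//= mulrC ler_wpM2r// lebesgue_measure_itv/= lte_fin.
case: ifPn => _ //=; last by rewrite ltW// cell_len_gt0.
Qed.

Lemma cvg_avg (J : set (partition01 R)) (x : L2 R D) : generating J -> cone x ->
  avg j x @[j --> net J] --> x.
Proof.
move=> gJ [f [f0 _ fi] <-]; have FF := net_proper gJ.
apply/cvgrPdist_lt => e e0.
have e2 : 0 < e ^+ 2 by exact: exprn_gt0.
have iff : leb.-integrable I (EFin \o (fun s => sdot (f s) (f s))).
  exact: integrable_sdot.
(* The parameterized integral below runs over closed intervals; adding the endpoint [1] changes no
   integral. *)
have iff1 : leb.-integrable `[0, 1] (EFin \o (fun s => sdot (f s) (f s))).
  have /integrableP[mf fy] := iff; apply/integrableP; split.
    by apply/emeasurable_fun_itv_bndo_bndcP.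
  rewrite -integral_itv_bndo_bndc//; exact: measurableT_comp.
(* The integral up to [c] is left-continuous at [c = 1], so the mass near [1] is small;
   [d = 1 - c]. *)
have [d /andP[d0 d1] hd] : exists2 d, 0 < d < 1 &
    \int[leb]_(s in I) sdot (f s) (f s) -
    \int[leb]_(s in `[0, 1 - d[) sdot (f s) (f s) < e ^+ 2.
  have := parameterized_integral_cvg_at_left (@ltr01 R) iff1.
  move=> /cvgrPdist_lt /(_ _ e2) h.
  have : \forall c \near (1 : R)^'-, [/\ 0 < c, c < 1 &
      `|parameterized_integral leb 0 1 (fun s => sdot (f s) (f s)) -
      parameterized_integral leb 0 c (fun s => sdot (f s) (f s))| < e ^+ 2].
    near=> c; split; [|by near: c; exact: nbhs_left_lt|by near: c; exact: h].
    by near: c; exact: nbhs_left_gt.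
  move=> /filter_ex[c [c0 c1 hc]]; exists (1 - c).
    by rewrite subr_gt0 c1 gtrBl.
  apply: le_lt_trans hc; rewrite /parameterized_integral subKr.
  rewrite -!Rintegral_itv_bndo_bndc ?ler_norm//.
  apply: (@integrableS _ _ _ leb _ _ _ (measurable_itv _)
      (measurable_itv _) _ iff).
  by move=> s /=; rewrite !in_itv/= => /andP[-> /lt_trans]; apply.
have [j0 [Jj0 hj0]] := generating_mesh gJ d0.
exists j0; split=> // j Jj j0j.
have h : l2_dot (l2_class f - avg j (l2_class f))
    (l2_class f - avg j (l2_class f)) < e ^+ 2.
  rewrite l2_dot_sub_avg; apply: le_lt_trans hd; rewrite l2_dotE lerB//.
  by apply: le_hj_dot_pj => //; [rewrite d0|exact: hj0].
rewrite /Num.norm/= /l2_norm -(ltr_pXn2r (n := 2)) ?nnegrE ?sqrtr_ge0 ?(ltW e0)//.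
by rewrite sqr_sqrtr ?l2_dot_ge0.
Unshelve. all: by end_near. Qed.

End Convergence.

(** * Comparison of the limit with the variational formula, one inequality at a time *)

Theorem proposition3p12 (R : realType) (D : nat) (D_ge1 : (1 <= D)%N)
    (J : set (partition01 R)) (J_gen : generating J)
    (psi : L2 R D -> R)
    (psi_incr : dual_increasing psi)
    (psi_cont : {within cone, continuous psi})
    (H : L2 R D -> R)
    (H_avg : forall (nu : L2 R D) (j : partition01 R),
      cone nu -> J j -> H (avg j nu) <= H nu)
    (f : forall j : partition01 R, R -> Hj D j -> \bar R)
    (f_gtNy : forall j, J j -> forall t x, 0 <= t -> conej x ->
      (-oo < f j t x)%E)
    (fE : forall j, J j -> forall t x, 0 <= t -> conej x ->
      f j t x =
        ereal_sup [set ereal_inf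
          [set (psi (lj (x + y)) - hj_dot y z + t * H (lj z))%:E
            | z in @conej R D j] | y in @conej R D j])
    (t : R) (t_ge0 : 0 <= t) (mu : L2 R D) (mu_cone : cone mu)
    (l : R)
    (f_cvg : lift_up (f j) t mu @[j --> net J] --> l%:E) :
  ereal_sup [set ereal_inf
    [set (psi (mu + nu) - l2_dot nu rho + t * H rho)%:E
      | rho in @cone R D] | nu in @cone R D] = l%:E.
Proof.
have FF := net_proper J_gen.
have netJ (P : partition01 R -> Prop) :
    (forall j, J j -> P j) -> \forall j \near net J, P j.
  move=> JP; have [j0 Jj0] := generating_neq0 J_gen.
  by exists j0; split=> // j Jj _; exact: JP.
apply/eqP; rewrite eq_le; apply/andP; split.
  apply: ge_ereal_sup => _ [nu nu_cone <-].
  (* For fixed [nu], the infimum is at most [err j + f_j] for every [j] in [J]; the bound by [l]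
     follows in the limit. *)
  pose err j := psi (mu + nu) - psi (avg j mu + avg j nu).
  have err0 : err j @[j --> net J] --> 0.
    rewrite -(subrr (psi (mu + nu))); apply: cvgB; first exact: cvg_cst.
    (* Continuity relative to the cone suffices, since the sums of averages stay in it. *)
    have /subspace_continuousP/(_ _ (coneD mu_cone nu_cone)) := psi_cont.
    apply: cvg_comp => A; rewrite /within/= => hA.
    have := cvgD (cvg_avg J_gen mu_cone) (cvg_avg J_gen nu_cone).
    move=> /(_ FF _ hA) [j0 [Jj0 h0]]; exists j0; split=> // j Jj j0j.
    by apply: h0 => //; apply: coneD; exact: cone_avg.
  have : ((err j)%:E + lift_up (f j) t mu)%E @[j --> net J] --> (0%:E + l%:E)%E.
    by apply: cvgeD => //; apply/cvg_EFin; [exact: nearW|exact: err0].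
  rewrite add0e => /cvge_to_ge; apply; apply: netJ => j Jj.
  rewrite /lift_up fE//; last exact: conej_pj.
  (* With [err j] moved to the left, [pj j nu] is a candidate in the supremum defining [f_j]; each
     [lj z] is then one in the infimum over [rho]. *)
  rewrite -leeBlDl//; apply: le_trans (ereal_sup_ubound _); last first.
    by exists (pj j nu) => //; exact: conej_pj.
  apply: le_ereal_inf_tmp => _ [z z_cone <-].
  rewrite leeBlDl// -EFinD; apply: ereal_inf_lbound; exists (lj z); first exact: cone_lj.
  congr EFin; rewrite ljD /err -/(avg j mu) -/(avg j nu) l2_dotC l2_dot_lj.
  have -> : hj_dot z (pj j nu) = hj_dot (pj j nu) z.
    by apply: eq_bigr => k _; rewrite sdotC.
  ring.
(* Converse inequality, valid before the limit: [lj y] competes in the supremum over [nu], and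
   [pj j rho] in the infimum over [z]. *)
apply: (cvge_to_le f_cvg); apply: netJ => j Jj.
rewrite /lift_up fE//; last exact: conej_pj.
apply: ge_ereal_sup => _ [y y_cone <-].
have ly := cone_lj y_cone.
apply: le_trans (ereal_sup_ubound _); last by exists (lj y).
apply: le_ereal_inf_tmp => _ [rho rho_cone <-].
apply: le_trans.
  by apply: ereal_inf_lbound; exists (pj j rho); first exact: conej_pj.
(* The pairings agree by adjointness, and the arguments of [psi] differ by [mu - avg j mu], an
   element of the dual cone. *)
rewrite lee_fin l2_dot_lj ljD lerD//; last by rewrite ler_wpM2l// H_avg.
rewrite lerB//; apply: psi_incr; [exact: coneD|by apply: coneD => //; exact: cone_avg|].
by rewrite opprD addrACA subrr addr0; exact: dual_cone_avg.
Qed.
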